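(* Up to isomorphism, there are exactly five connected strongly regular signed graphs (SRSGs) that are $5$-regular and $3$ net-regular, namely $\dot G_1$, $\dot S^1_8$, $\dot S^1_{10}$, $\dot S^2_{10}$ and $\dot S^3_{10}$ (defined in the context). Their parameters are $(6,5,0,4)$ for $\dot G_1$ (complete), $(8,5,-2,4,4)$ for $\dot S^1_8$, $(10,5,-2,4,2)$ for $\dot S^1_{10}$, $(10,5,0,0,1)$ for $\dot S^2_{10}$ and $(10,5,3,0,-2)$ for $\dot S^3_{10}$.
   Context: A signed graph $\dot G=(G,\sigma)$ is a simple graph $G$ (the underlying graph) with a sign function $\sigma:E(G)\to\{+1,-1\}$; its adjacency matrix $A_{\dot G}=(a_{ij})$ has $a_{ij}=\sigma(v_iv_j)$ if $v_i\sim v_j$ and $0$ otherwise. Connectedness and the degree $d(v)$ refer to the underlying graph. $d^+(v)$ and $d^-(v)$ denote the numbers of positive and negative edges at $v$; the net-degree of $v$ is $d^+(v)-d^-(v)$, and $\dot G$ is $\rho$ net-regular if every vertex has net-degree $\rho$. $\dot G$ is homogeneous if all its edges have the same sign. Note $(A_{\dot G}^2)_{ij}$ equals the number of positive walks of length 2 from $v_i$ to $v_j$ minus the number of negative ones (the sign of a walk is the product of its edge signs). $\dot G$ on $n$ vertices is a strongly regular signed graph (SRSG) if it is neither a homogeneous complete graph nor edgeless, and there exist $r\in\mathbb N$ and $a,b,c\in\mathbb Z$ with $(A_{\dot G}^2)_{ii}=r$ for all $i$, $(A_{\dot G}^2)_{ij}=a$ whenever $v_iv_j$ is a positive edge, $=b$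 whenever $v_iv_j$ is a negative edge, and $=c$ whenever $i\ne j$ and $v_i\not\sim v_j$. Its parameters are written $(n,r,a,b,c)$ if $G$ is non-complete and $(n,r,a,b)$ if $G$ is complete. Isomorphism of signed graphs means a graph isomorphism preserving edge signs. The graphs: $\dot G_1$ is $K_6$ whose negative edges form a perfect matching (three pairwise disjoint edges), all other edges positive. For $m\in\{4,5\}$, $\dot S^1_{2m}$ has vertex set $\{x_t,y_t: t\in\mathbb Z_m\}$, with $x_ty_t$ a negative edge for each $t$, all four edges between $\{x_t,y_t\}$ and $\{x_{t+1},y_{t+1}\}$ positive for each $t$, and no other edges (i.e. the lexicographic product $C_m[K_2]$ with the $K_2$-edges negative); $\dot S^1_8$ corresponds to $m=4$ and $\dot S^1_{10}$ to $m=5$. $\dot S^2_{10}$ is the complete bipartite graph $K_{5,5}$ whose negative edges form a perfect matching, all other edges positive. $\dot S^3_{10}$ consists of two vertex-disjoint complete graphs $K_5$ on $\{u_1,\dots,u_5\}$ and $\{w_1,\dots,w_5\}$ with all their edges positive, together with the negative edges $u_tw_t$, $t=1,\dots,5$. *)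

(* Defs.v *)
(* A signed graph on n vertices is represented by its signed
   adjacency matrix A : 'M[int]_n (entries in {-1,0,1}, symmetric, zero diagonal). *)
From mathcomp Require Import all_boot all_order all_algebra.
Set Implicit Arguments. Unset Strict Implicit. Unset Printing Implicit Defensive.
Import Order.TTheory GRing.Theory Num.Theory.
Local Open Scope ring_scope.

Section SignedGraphs.
Variable n : nat.
Implicit Type A : 'M[int]_n.

Definition signed_adj A : Prop :=
  [/\ forall i j, A i j \in [:: -1; 0; 1],
      forall i j, A i j = A j i &
      forall i, A i i = 0].

Definition adjacent A (i j : 'I_n) : bool := A i j != 0.

Definition sg_connected A : Prop := forall i j, connect (adjacent A) i j.

Definition degree A (i : 'I_n) : nat := #|[set j | adjacent A i j]|.

(* d^+(v) - d^-(v) *)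
Definition net_degree A (i : 'I_n) : int := \sum_j A i j.

Definition sg_regular A (k : nat) : Prop := forall i, degree A i = k.
Definition net_regular A (rho : int) : Prop := forall i, net_degree A i = rho.

Definition underlying_complete A : Prop := forall i j, i != j -> A i j != 0.
Definition edgeless A : Prop := forall i j, A i j = 0.
Definition homogeneous A : Prop :=
  (forall i j, A i j != 0 -> A i j = 1) \/ (forall i j, A i j != 0 -> A i j = -1).

Definition srsg_cond A (r : nat) (a b c : int) : Prop :=
  [/\ forall i, (A *m A) i i = r%:Z,
      forall i j, A i j = 1 -> (A *m A) i j = a,
      forall i j, A i j = -1 -> (A *m A) i j = b &
      forall i j, i != j -> A i j = 0 -> (A *m A) i j = c].

Definition nondegenerate A : Prop :=
  ~ (underlying_complete A /\ homogeneous A) /\ ~ edgeless A.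

Definition is_SRSG A : Prop :=
  nondegenerate A /\ exists r a b c, srsg_cond A r a b c.

Definition SRSG_params5 A (r : nat) (a b c : int) : Prop :=
  [/\ nondegenerate A, ~ underlying_complete A & srsg_cond A r a b c].

(* parameters (n,r,a,b) : complete underlying graph (c is vacuous) *)
Definition SRSG_params4 A (r : nat) (a b : int) : Prop :=
  [/\ nondegenerate A, underlying_complete A & exists c, srsg_cond A r a b c].

End SignedGraphs.

Definition sg_iso n m (A : 'M[int]_n) (B : 'M[int]_m) : Prop :=
  exists f : 'I_n -> 'I_m, bijective f /\ forall i j, B (f i) (f j) = A i j.

(* G1: K_6 with negative perfect matching {0,1},{2,3},{4,5} *)
Definition G1 : 'M[int]_6 :=
  \matrix_(i, j) let i : nat := i in let j : nat := j in (if (i == j)%N then 0 else if (i./2 == j./2)%N then -1 else 1).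

(* S^1_{2m} = C_m[K_2], K_2-edges negative; vertex k is x_t (k=2t) or y_t (k=2t+1) *)
Definition S1 (m : nat) : 'M[int]_(m.*2) :=
  \matrix_(i, j) let i : nat := i in let j : nat := j in
    (if (i == j)%N then 0
     else if (i./2 == j./2)%N then -1
     else if ((j./2 == (i./2).+1 %% m) || (i./2 == (j./2).+1 %% m))%N then 1
     else 0).

Definition S1_8 : 'M[int]_8 := S1 4.
Definition S1_10 : 'M[int]_10 := S1 5.

(* S^2_10 : K_{5,5} on parts {0..4},{5..9}, negative perfect matching t -- t+5 *)
Definition S2_10 : 'M[int]_10 :=
  \matrix_(i, j) let i : nat := i in let j : nat := j in
    (if ((i < 5) == (j < 5))%N then 0
     else if ((i == j + 5) || (j == i + 5))%N then -1 else 1).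

(* S^3_10 : two positive K_5 on {0..4},{5..9} plus negative edges t -- t+5 *)
Definition S3_10 : 'M[int]_10 :=
  \matrix_(i, j) let i : nat := i in let j : nat := j in
    (if (i == j)%N then 0
     else if ((i < 5) == (j < 5))%N then 1
     else if ((i == j + 5) || (j == i + 5))%N then -1 else 0).

(* Main.v *)
(* At each vertex the positive edges form a 4-regular graph P and the negative edges a
   perfect matching M, so A = P - M and A^2 = 5 + a P + b M + c (J - 1 - P - M).  Row sums
   give 4a + b + c(n - 6) = 4, and A^2 A = A A^2 gives (a + b - 2c)(PM - MP) = 0.
   If a + b = 2c, then b = 4 or (n, a, b, c) = (8, 0, 2, 1); the latter is excluded because
   tr A^3 = n(4a - b) counts each signed triangle six times, hence is divisible by 3.
   If b = 4, mates are twins in P, so P is a blown-up cycle whose length is 3, 4 or 5.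
   Otherwise PM = MP: M acts as an automorphism of P, and b, the number of common P-neighbours
   of two mates, is even.  The case b = 2 dies on comparing a at the two kinds of
   neighbours of a vertex i.  For b = 0 a neighbour u of i shares a neighbours with i, its
   mate shares c + 2, and these are disjoint subsets of the other three neighbours of i,
   so a + c <= 1.  With n >= 10 the count leaves (a, c) = (3, -2), which gives two
   positive K_5; (0, 1), which gives K_{5,5}; and (2, -1), (1, 0), where the number of
   common neighbours of two adjacent neighbours of i comes out wrong. *)
Require Import Defs.
From mathcomp Require Import all_boot all_order all_algebra.
From mathcomp Require Import zify ring.
Set Implicit Arguments. Unset Strict Implicit. Unset Printing Implicit Defensive.
Import Order.TTheory GRing.Theory Num.Theory.
Local Open Scope ring_scope.

(** * Computable checks for matrices given by functions on natural numbers *)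

Definition mx_of (m : nat) (F : nat -> nat -> int) : 'M[int]_m :=
  \matrix_(i, j) F i j.

Definition all_pairs (m : nat) (Q : nat -> nat -> bool) : bool :=
  all (fun i => all (Q i) (iota 0 m)) (iota 0 m).

Lemma all_pairsP m (Q : nat -> nat -> bool) (i j : 'I_m) :
  all_pairs m Q -> Q i j.
Proof.
by move=> /allP/(_ i); rewrite mem_iota /= => /(_ (ltn_ord i)) /allP/(_ j);
  rewrite mem_iota /= => /(_ (ltn_ord j)).
Qed.

(** A fold over [iota] evaluates under [vm_compute], unlike a locked big operator. *)
Definition sq_entry (m : nat) (F : nat -> nat -> int) (i j : nat) : int :=
  foldr (fun k s => F i k * F k j + s) 0 (iota 0 m).

Lemma mx_of_sq m F (i j : 'I_m) :
  (mx_of m F *m mx_of m F) i j = sq_entry m F i j.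
Proof.
rewrite mxE /sq_entry.
under eq_bigr do rewrite !mxE.
rewrite -(big_mkord xpredT (fun k => F i k * F k j)) /index_iota subn0.
by elim: (iota 0 m) => [|k s IHs]; rewrite ?big_nil ?big_cons //= IHs.
Qed.

Lemma mx_of_degree m F (i : 'I_m) :
  degree (mx_of m F) i = count (fun k => F i k != 0) (iota 0 m).
Proof.
have -> : iota 0 m = index_iota 0 m by rewrite /index_iota subn0.
rewrite /degree -sum1_card -sum1_count big_mkord.
by apply: eq_bigl => k; rewrite inE /adjacent mxE.
Qed.

Lemma mx_of_net_degree m F (i : 'I_m) :
  net_degree (mx_of m F) i = foldr (fun k s => F i k + s) 0 (iota 0 m).
Proof.
rewrite /net_degree.
under eq_bigr do rewrite !mxE.
rewrite -(big_mkord xpredT (F i)) /index_iota subn0.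
by elim: (iota 0 m) => [|k s IHs]; rewrite ?big_nil ?big_cons //= IHs.
Qed.

(** Connectedness is tested as diameter at most 2, which holds for all five underlying graphs. *)
Definition regular_check m F (r : nat) (rho : int) :=
  all_pairs m (fun i j =>
    [&& F i j \in [:: -1; 0; 1], F i j == F j i, F i i == 0,
     [|| i == j, F i j != 0 | has (fun k => (F i k != 0) && (F k j != 0)) (iota 0 m)],
     count (fun k => F i k != 0) (iota 0 m) == r
     & foldr (fun k s => F i k + s) 0 (iota 0 m) == rho]).

Lemma regular_checkP m F r rho : regular_check m F r rho ->
  [/\ signed_adj (mx_of m F), sg_connected (mx_of m F),
      sg_regular (mx_of m F) r & net_regular (mx_of m F) rho].
Proof.
move=> chk; have H (i j : 'I_m) := all_pairsP i j chk.
split.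
- by split=> [i j|i j|i]; rewrite !mxE;
    [case/and3P: (H i j) | case/and3P: (H i j) => _ /eqP | case/and4P: (H i i) => _ _ /eqP].
- move=> i j; case/and5P: (H i j) => _ _ _ /or3P[/eqP/ord_inj-> | ij | ij] _.
  + exact: connect0.
  + by apply: connect1; rewrite /adjacent mxE.
  case/hasP: ij => k; rewrite mem_iota => /= km /andP[ik kj].
  by apply: (@connect_trans _ _ (Ordinal km)); apply: connect1; rewrite /adjacent mxE.
- by move=> i; rewrite mx_of_degree; case/and5P: (H i i) => _ _ _ _ /andP[/eqP].
by move=> i; rewrite mx_of_net_degree; case/and5P: (H i i) => _ _ _ _ /andP[_ /eqP].
Qed.

Definition srsg_check m F (r : nat) (a b c : int) :=
  all_pairs m (fun i j => sq_entry m F i j ==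
    if i == j then r%:Z else if F i j == 1 then a else if F i j == -1 then b
    else if F i j == 0 then c else sq_entry m F i j).

Lemma srsg_checkP m F r a b c : srsg_check m F r a b c -> 
  all_pairs m (fun i j => F i i == 0) -> srsg_cond (mx_of m F) r a b c.
Proof.
move=> chk chk0; have H (i j : 'I_m) := eqP (all_pairsP i j chk).
have F0 (i : 'I_m) : F i i = 0 by apply/eqP; apply: (all_pairsP i i chk0).
split=> [i|i j|i j|i j ij]; rewrite ?mx_of_sq ?mxE H ?eqxx //.
- by move=> Fij; rewrite Fij; case: (i =P j :> nat) => // /ord_inj ij; rewrite ij F0 in Fij.
- by move=> Fij; rewrite Fij; case: (i =P j :> nat) => // /ord_inj ij; rewrite ij F0 in Fij.
by move=> Fij; rewrite Fij; case: (i =P j :> nat) ij => // /ord_inj->; rewrite eqxx.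
Qed.

Lemma nondegenerate_witness n (A : 'M[int]_n) i j k l :
  A i j = 1 -> A k l = -1 -> Defs.nondegenerate A.
Proof.
move=> Aij Akl; split=> [[_ [hp | hn]] | /(_ i j)]; last by rewrite Aij.
  by have := hp k l; rewrite Akl => /(_ isT).
by have := hn i j; rewrite Aij => /(_ isT).
Qed.

Lemma sg_iso_size n m (A : 'M[int]_n) (B : 'M[int]_m) : sg_iso A B -> n = m.
Proof. by case=> f [/bij_eq_card]; rewrite !card_ord. Qed.

(** Reindexing along the bijection carries the square of [A] to that of [B], and one positive edge
    then pins down [a]. *)
Lemma sg_iso_params n m (A : 'M[int]_n) (B : 'M[int]_m) r a b c r' a' b' c' i j :
  sg_iso A B -> A i j = 1 -> srsg_cond A r a b c -> srsg_cond B r' a' b' c' -> a = a'.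
Proof.
case=> f [bij_f fP] Aij [_ Aa _ _] [_ Ba _ _].
rewrite -(Aa i j Aij) -(Ba (f i) (f j)); last by rewrite fP.
rewrite !mxE (reindex f); last exact: onW_bij.
by apply: eq_bigr => k _; rewrite !fP.
Qed.

(** * The five graphs: regularity, parameters, non-isomorphism *)

Definition F_S1 (m i j : nat) : int :=
  if (i == j)%N then 0
  else if (i./2 == j./2)%N then -1
  else if ((j./2 == (i./2).+1 %% m) || (i./2 == (j./2).+1 %% m))%N then 1
  else 0.
Definition F_S2 (i j : nat) : int :=
  if ((i < 5) == (j < 5))%N then 0
  else if ((i == j + 5) || (j == i + 5))%N then -1 else 1.
Definition F_S3 (i j : nat) : int :=
  if (i == j)%N then 0
  else if ((i < 5) == (j < 5))%N then 1
  else if ((i == j + 5) || (j == i + 5))%N then -1 else 0.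

(** K_6 is C_3[K_2], so [G1] is the case m = 3 of the family [S1] and is classified together with
    it. *)
Lemma G1E : G1 = mx_of 6 (F_S1 3).
Proof.
apply/matrixP => i j; rewrite !mxE /=; apply/eqP.
by apply: (@all_pairsP 6 (fun i j => (if (i == j)%N then 0 else
  if (i./2 == j./2)%N then -1 else 1) == F_S1 3 i j)).
Qed.

Lemma regular_G1 : regular_check 6 (F_S1 3) 5 3. Proof. by vm_compute. Qed.
Lemma regular_S1_8 : regular_check 8 (F_S1 4) 5 3. Proof. by vm_compute. Qed.
Lemma regular_S1_10 : regular_check 10 (F_S1 5) 5 3. Proof. by vm_compute. Qed.
Lemma regular_S2_10 : regular_check 10 F_S2 5 3. Proof. by vm_compute. Qed.
Lemma regular_S3_10 : regular_check 10 F_S3 5 3. Proof. by vm_compute. Qed.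

(** In a complete graph the condition on [c] is vacuous, so its value 0 is arbitrary. *)
Lemma srsg_G1 : srsg_cond G1 5 0 4 0.
Proof. by rewrite G1E; apply: srsg_checkP; vm_compute. Qed.
Lemma srsg_S1_8 : srsg_cond S1_8 5 (-2) 4 4.
Proof. by apply: (@srsg_checkP 8 (F_S1 4)); vm_compute. Qed.
Lemma srsg_S1_10 : srsg_cond S1_10 5 (-2) 4 2.
Proof. by apply: (@srsg_checkP 10 (F_S1 5)); vm_compute. Qed.
Lemma srsg_S2_10 : srsg_cond S2_10 5 0 0 1.
Proof. by apply: (@srsg_checkP 10 F_S2); vm_compute. Qed.
Lemma srsg_S3_10 : srsg_cond S3_10 5 3 0 (-2).
Proof. by apply: (@srsg_checkP 10 F_S3); vm_compute. Qed.

Lemma params5I n (A : 'M[int]_n) i j k l u v r a b c :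
  A i j = 1 -> A k l = -1 -> u != v -> A u v = 0 -> srsg_cond A r a b c ->
  SRSG_params5 A r a b c.
Proof.
move=> Aij Akl uv Auv cond; split=> //; first exact: nondegenerate_witness Aij Akl.
by move=> /(_ u v uv); rewrite Auv eqxx.
Qed.

Lemma params_five :
  [/\ SRSG_params4 G1 5 0 4,
      SRSG_params5 S1_8 5 (-2) 4 4,
      SRSG_params5 S1_10 5 (-2) 4 2,
      SRSG_params5 S2_10 5 0 0 1 &
      SRSG_params5 S3_10 5 3 0 (-2)].
Proof.
split.
- split; last by exists 0; exact: srsg_G1.
    by apply: (@nondegenerate_witness _ _ (inord 0) (inord 2) (inord 0) (inord 1));
      rewrite mxE !inordK.
  by move=> i j ij; rewrite mxE /= val_eqE (negbTE ij); case: ifP.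
(* The six indices are a positive edge, a negative edge and a non-adjacent pair. *)
- by apply: (@params5I _ _ (inord 0) (inord 2) (inord 0) (inord 1) (inord 0) (inord 4)
    _ _ _ _ _ _ _ _ srsg_S1_8); rewrite -?val_eqE ?mxE /= !inordK.
- by apply: (@params5I _ _ (inord 0) (inord 2) (inord 0) (inord 1) (inord 0) (inord 4)
    _ _ _ _ _ _ _ _ srsg_S1_10); rewrite -?val_eqE ?mxE /= !inordK.
- by apply: (@params5I _ _ (inord 0) (inord 6) (inord 0) (inord 5) (inord 0) (inord 1)
    _ _ _ _ _ _ _ _ srsg_S2_10); rewrite -?val_eqE ?mxE /= !inordK.
- by apply: (@params5I _ _ (inord 0) (inord 1) (inord 0) (inord 5) (inord 0) (inord 6)
    _ _ _ _ _ _ _ _ srsg_S3_10); rewrite -?val_eqE ?mxE /= !inordK.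
Qed.

(** Orders 6, 8 and 10 separate all but the last three graphs, whose values of [a] are -2, 0 and
    3. *)
Lemma five_distinct :
  [/\ ~ sg_iso G1 S1_8, ~ sg_iso G1 S1_10, ~ sg_iso G1 S2_10 & ~ sg_iso G1 S3_10] /\
  [/\ ~ sg_iso S1_8 S1_10, ~ sg_iso S1_8 S2_10 & ~ sg_iso S1_8 S3_10] /\
  [/\ ~ sg_iso S1_10 S2_10, ~ sg_iso S1_10 S3_10 & ~ sg_iso S2_10 S3_10].
Proof.
split; first by split=> /sg_iso_size.
split; first by split=> /sg_iso_size.
have pos1 : S1_10 (inord 0) (inord 2) = 1 by rewrite mxE /= !inordK.
have pos2 : S2_10 (inord 0) (inord 6) = 1 by rewrite mxE /= !inordK.
split=> iso.
- by have := sg_iso_params iso pos1 srsg_S1_10 srsg_S2_10.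
- by have := sg_iso_params iso pos1 srsg_S1_10 srsg_S3_10.
- by have := sg_iso_params iso pos2 srsg_S2_10 srsg_S3_10.
Qed.

(* A map realizing F inside A is injective because F separates rows, and its image
   is closed under adjacency because both graphs have the same degree. *)
Lemma sg_iso_of_embedding n m (A : 'M[int]_n) (F : nat -> nat -> int) r (g : nat -> 'I_n) :
  (0 < m)%N -> sg_connected A -> sg_regular A r -> sg_regular (mx_of m F) r ->
  all_pairs m (fun i j => (i == j) || has (fun k => F i k != F j k) (iota 0 m)) ->
  (forall s t, (s < m)%N -> (t < m)%N -> A (g s) (g t) = F s t) ->
  sg_iso A (mx_of m F).
Proof.
move=> m_gt0 conA regA regF sepF AF; pose h (i : 'I_m) := g i.
have AFh i j : A (h i) (h j) = mx_of m F i j by rewrite mxE AF.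
have inj_h : injective h.
  move=> i j hij; case/orP: (all_pairsP i j sepF) => [/eqP/ord_inj //|].
  case/hasP=> k; rewrite mem_iota => /= km.
  by have := AFh i (Ordinal km); rewrite hij AFh !mxE => ->; rewrite eqxx.
have closed_h i x : adjacent A (h i) x -> x \in codom h.
  move=> hix; have /eqP im :
      h @: [set j | adjacent (mx_of m F) i j] == [set x | adjacent A (h i) x].
    rewrite eqEcard card_imset //; apply/andP; split.
      by apply/subsetP => _ /imsetP[j + ->]; rewrite !inE /adjacent AFh.
    by have := regA (h i); have := regF i; rewrite /degree => -> ->.
  have : x \in [set x | adjacent A (h i) x] by rewrite inE.
  by rewrite -im => /imsetP[j _ ->]; exact: codom_f.
have surj x : x \in codom h.
  case/connectP: (conA (h (Ordinal m_gt0)) x) => p.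
  have : h (Ordinal m_gt0) \in codom h by exact: codom_f.
  elim: p (h _) => [|y p IHp] z zh /=; first by move=> _ ->.
  case/andP=> zy; apply: IHp; case/codomP: zh zy => i ->; exact: closed_h.
have bij_h : bijective h.
  exists (fun x => iinv (surj x)) => [i|x]; last exact: f_iinv.
  by apply: inj_h; rewrite f_iinv.
case: bij_h => f hK fK; exists f; split; first by exists h.
by move=> i j; rewrite -AFh !fK.
Qed.

(** * Counting by orbits: parity and divisibility by 3 *)

(** All orbits have size two; the induction removes one orbit at a time. *)
Lemma even_card_involution (T : finType) (f : T -> T) (K : {set T}) :
  involutive f -> (forall x, f x != x) -> (forall x, x \in K -> f x \in K) ->
  ~~ odd #|K|.
Proof.
move=> fK f_neq; have [m] := ubnP #|K|; elim: m K => // m IHm K ltKm K_f.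
have [->|[x xK]] := set_0Vmem K; first by rewrite cards0.
have fxK : f x \in K :\ x by rewrite !inE f_neq K_f.
rewrite (cardsD1 x) xK (cardsD1 (f x)) fxK /= negbK; apply: IHm.
  by move: ltKm; rewrite (cardsD1 x) xK (cardsD1 (f x)) fxK; lia.
move=> y; rewrite !inE => /and3P[yfx yx yK].
by rewrite (inj_eq (can_inj fK)) yx K_f // (can2_eq fK fK) yfx.
Qed.

(** Triples with a repeated entry contribute 0; the others fall into rotation classes of size three,
    on which [F] is constant. *)
Lemma sum_cyclic_dvd3 (n : nat) (F : 'I_n -> 'I_n -> 'I_n -> int) :
  (forall i j k, F i j k = F j k i) -> (forall i k, F i i k = 0) ->
  (3 %| \sum_i \sum_j \sum_k F i j k)%Z.
Proof.
move=> Fcyc Fdiag.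
(* m marks the rotation of a triple that starts at its least entry. *)
pose m (i j k : 'I_n) : int := ((i < j) && (i < k))%N.
have Fsplit i j k : F i j k = F i j k * m i j k + F j k i * m j k i + F k i j * m k i j.
  rewrite (Fcyc k i j) -(Fcyc i j k) -!mulrDr /m.
  have [->|ij] := eqVneq i j; first by rewrite Fdiag mul0r.
  have [->|jk] := eqVneq j k; first by rewrite Fcyc Fdiag mul0r.
  have [->|ki] := eqVneq k i; first by rewrite -Fcyc Fdiag mul0r.
  rewrite -[LHS]mulr1; congr (_ * _); move: ij jk ki; rewrite -!val_eqE /=; lia.
pose S := \sum_i \sum_j \sum_k F i j k * m i j k.
suff -> : \sum_i \sum_j \sum_k F i j k = 3 * S by rewrite dvdz_mulr.
have S2 : \sum_i \sum_j \sum_k F j k i * m j k i = S.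
  by rewrite exchange_big /=; apply: eq_bigr => j _; rewrite exchange_big.
have S3 : \sum_i \sum_j \sum_k F k i j * m k i j = S.
  under eq_bigr do rewrite exchange_big /=.
  by rewrite exchange_big.
have -> : 3 * S = S + S + S by ring.
rewrite -{2}S2 -{2}S3 /S -!big_split /=; apply: eq_bigr => i _.
rewrite -!big_split /=; apply: eq_bigr => j _.
by rewrite -!big_split /=; apply: eq_bigr => k _.
Qed.

(** * The decomposition A = P - M into positive edges and a negative perfect matching *)

Section SignedGraph.
Variables (n : nat) (A : 'M[int]_n).
Hypotheses (sgA : signed_adj A) (regA : sg_regular A 5) (netA : net_regular A 3).

Definition pos (i j : 'I_n) : bool := A i j == 1.
(** By [card_edges] each vertex has exactly one negative neighbour, so the default [i] is never
    taken. *)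
Definition mate (i : 'I_n) : 'I_n := odflt i [pick j | A i j == -1].
Definition codeg (i j : 'I_n) : nat := #|[set k | pos i k && pos j k]|.

Lemma entryE i j : A i j = (pos i j)%:Z - (A i j == -1)%:Z.
Proof. by case: sgA => /(_ i j) + _ _; rewrite !inE /pos => /or3P[]/eqP->. Qed.

(** Degree and net-degree give d^+ + d^- = 5 and d^+ - d^- = 3. *)
Lemma card_edges i :
  #|[set j | pos i j]| = 4%N /\ #|[set j | A i j == -1]| = 1%N.
Proof.
have deg : (#|[set j | pos i j]| + #|[set j | A i j == -1%R]| = 5)%N.
  rewrite -(regA i) /degree -cardsUI [X in (_ + X)%N](_ : _ = 0%N).
    rewrite addn0; apply: eq_card => j; rewrite !inE /adjacent /pos.
    by case: sgA => /(_ i j) + _ _; rewrite !inE => /or3P[]/eqP->.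
  by apply: eq_card0 => j; rewrite !inE /pos; case: eqP => // ->.
have net : #|[set j | pos i j]|%:Z - #|[set j | A i j == -1]|%:Z = 3.
  rewrite -(netA i) /net_degree.
  under [RHS]eq_bigr do rewrite entryE.
  rewrite -!sum1_card big_split /= sumrN -!(big_morph Posz PoszD (erefl _)).
  by congr (Posz _ - Posz _); rewrite [LHS]big_mkcond /=; apply: eq_bigr => j _;
    rewrite inE; case: ifP.
by split; lia.
Qed.

Lemma entryC i j : A i j = A j i. Proof. by case: sgA. Qed.
Lemma posC i j : pos i j = pos j i. Proof. by rewrite /pos entryC. Qed.
Lemma posxx i : pos i i = false. Proof. by case: sgA => _ _ A0; rewrite /pos A0. Qed.

Lemma neg_mate i j : (A i j == -1) = (j == mate i).
Proof.
have [_ /eqP/cards1P[k negE]] := card_edges i.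
have negk x : (A i x == -1) = (x == k) by rewrite -[RHS]in_set1 -negE inE.
rewrite negk /mate; case: pickP => [x /=|/(_ k)]; last by rewrite negk eqxx.
by rewrite negk => /eqP->.
Qed.

Lemma mateK : involutive mate.
Proof. by move=> i; apply/eqP; rewrite eq_sym -neg_mate entryC neg_mate. Qed.

Lemma eq_mate i j : (mate i == j) = (i == mate j).
Proof. exact: can2_eq mateK mateK _ _. Qed.

Lemma mate_neq i : mate i != i.
Proof. by rewrite eq_sym -neg_mate; case: sgA => _ _ ->. Qed.

Lemma pos_mate i : pos i (mate i) = false.
Proof. by rewrite /pos; have := neg_mate i (mate i); rewrite eqxx => /eqP->. Qed.

Lemma AE i j : A i j = (pos i j)%:Z - (j == mate i)%:Z.
Proof. by rewrite -neg_mate -entryE. Qed.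

Lemma sum_pos i : \sum_j (pos i j)%:Z = 4.
Proof.
have -> : 4 = #|[set j | pos i j]|%:Z by case: (card_edges i) => ->.
rewrite -sum1_card (big_morph Posz PoszD (erefl _)).
by rewrite [RHS]big_mkcond; apply: eq_bigr => j _; rewrite inE; case: pos.
Qed.

Lemma sum_eq i (F : 'I_n -> int) : \sum_j (j == i)%:Z * F j = F i.
Proof.
rewrite (bigD1 i) //= eqxx mul1r big1 ?addr0 // => j /negbTE->.
exact: mul0r.
Qed.

Lemma sum_eq1 i : \sum_(j < n) (j == i)%:Z = 1.
Proof. by rewrite -[RHS](sum_eq i (fun=> 1)); apply: eq_bigr => j _; rewrite mulr1. Qed.

Lemma sum_row i : \sum_j A i j = 3. Proof. exact: netA. Qed.

Lemma even_order : ~~ odd n.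
Proof.
rewrite -[n in odd n]card_ord -cardsT.
by apply: even_card_involution mateK mate_neq _ => x; rewrite inE.
Qed.

(** Entrywise form of P^2 = A^2 + PM + MP - M^2, where M^2 = I. *)
Lemma codegE i j :
  (codeg i j)%:Z = (A *m A) i j + (pos i (mate j))%:Z + (pos (mate i) j)%:Z - (i == j)%:Z.
Proof.
have -> : (codeg i j)%:Z = \sum_k (pos i k)%:Z * (pos j k)%:Z.
  rewrite /codeg -sum1_card (big_morph Posz PoszD (erefl _)) big_mkcond.
  by apply: eq_bigr => k _; rewrite inE; do 2 case: pos.
rewrite mxE -(sum_eq (mate i) (fun k => (pos k j)%:Z)).
rewrite -(sum_eq (mate j) (fun k => (pos i k)%:Z)).
have -> : (i == j)%:Z = \sum_k (k == mate i)%:Z * (k == mate j)%:Z.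
  by rewrite sum_eq (inj_eq (can_inj mateK)).
rewrite -!big_split -sumrB /=; apply: eq_bigr => k _.
rewrite [A i k]AE [A k j]AE (posC j k) (eq_sym j) eq_mate; ring.
Qed.

Lemma codegxx i : codeg i i = 4%N.
Proof.
have [<- _] := card_edges i; apply: eq_card => j; rewrite !inE andbb //.
Qed.

(** * Relations between the parameters of a strongly regular signed graph *)

Variables (r : nat) (a b c : int).
Hypothesis cond : srsg_cond A r a b c.

(** Entrywise form of A^2 = c J + (5 - c) I + (a - c) P + (b - c) M. The diagonal value 5 comes from
    [codegE], which eliminates [r]. *)
Lemma sqE i j : (A *m A) i j =
  c + (5 - c) * (j == i)%:Z + (a - c) * (pos i j)%:Z + (b - c) * (j == mate i)%:Z.
Proof.
case: cond => _ sqa sqb sqc.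
have [->|ji] := eqVneq j i.
  have := codegE i i; rewrite codegxx (posC (mate i)) !pos_mate eqxx posxx.
  by rewrite eq_sym (negbTE (mate_neq i)); lia.
case p_ij: (pos i j).
  have -> : (j == mate i) = false.
    by apply/eqP => jE; move: p_ij; rewrite jE pos_mate.
  by rewrite (sqa _ _ (eqP p_ij)) /=; ring.
case: (eqVneq j (mate i)) => [jE | jmi].
  by rewrite sqb /=; [ring | apply/eqP; rewrite neg_mate jE].
by rewrite sqc // 1?eq_sym // ?AE ?p_ij ?(negbTE jmi) //=; ring.
Qed.

Lemma param_count (i : 'I_n) : 4 * a + b + c * (n%:Z - 6) = 4.
Proof.
(* Rows of A sum to 3, so rows of A^2 sum to 3 * 3. *)
have : \sum_j (A *m A) i j = 9.
  under eq_bigr do rewrite mxE.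
  rewrite exchange_big /=.
  under eq_bigr do rewrite -mulr_sumr sum_row.
  by rewrite -mulr_suml sum_row.
under eq_bigr do rewrite sqE.
rewrite !big_split /= -!mulr_sumr sum_pos sumr_const card_ord.
rewrite !sum_eq1 -mulr_natr; lia.
Qed.

(** Multiplying [sqE] by A with P = A + M gives A^3 = 3c J + (5 - c) A + (a - c) A^2 + (a + b - 2c)
    MA. All other terms are symmetric, so MA = AM unless a + b = 2c. *)
Lemma mate_commutes : a + b = 2 * c \/ forall i j, pos (mate i) j = pos i (mate j).
Proof.
have [|ab] := eqVneq (a + b) (2 * c); [by left | right].
have XA i j : (A *m A *m A) i j =
    3 * c + (5 - c) * A i j + (a - c) * (A *m A) i j + (a + b - 2 * c) * A (mate i) j.
  rewrite mxE.
  transitivity (\sum_k (c * A j k + (5 - c) * ((k == i)%:Z * A k j) +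
    (a - c) * (A i k * A k j) + (a + b - 2 * c) * ((k == mate i)%:Z * A k j))).
    by apply: eq_bigr => k _; rewrite sqE [A i k]AE (entryC j k); ring.
  by rewrite !big_split /= -!mulr_sumr sum_row !sum_eq [(A *m A) i j]mxE; ring.
have symAA i j : (A *m A) i j = (A *m A) j i.
  by rewrite !mxE; apply: eq_bigr => k _; rewrite (entryC i k) (entryC k j) mulrC.
have symAAA i j : (A *m A *m A) i j = (A *m A *m A) j i.
  rewrite -{1}mulmxA !mxE; apply: eq_bigr => k _.
  by rewrite (entryC i k) symAA mulrC.
move=> i j; have := symAAA i j; rewrite !XA (entryC j i) (symAA j i) => /addrI/eqP.
rewrite -subr_eq0 -mulrBr mulf_eq0 subr_eq0 (negbTE ab) subr_eq0 /=.
by rewrite (entryC _ i) /pos => /eqP->.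
Qed.

(** This is the trace of A^3: in each row of A^2, the four positive edges contribute [a] each and
    the negative edge contributes -b. *)
Lemma triangles_dvd3 : (3 %| n%:Z * (4 * a - b))%Z.
Proof.
have -> : n%:Z * (4 * a - b) = \sum_i \sum_j \sum_k A i j * A j k * A k i.
  transitivity (\sum_(i < n) (4 * a - b)).
    by rewrite sumr_const card_ord -[RHS]mulr_natl (natz n).
  apply: eq_bigr => i _; rewrite exchange_big /=.
  transitivity (\sum_k (a * (pos i k)%:Z - b * ((k == mate i)%:Z * 1))).
    by rewrite sumrB -!mulr_sumr sum_pos sum_eq; ring.
  apply: eq_bigr => k _; rewrite -mulr_suml.
  have := sqE i k; rewrite mxE => ->; rewrite entryC AE.
  case: (eqVneq k i) => [->|ki]; first
    by rewrite posxx (eq_sym i (mate i)) (negbTE (mate_neq i)) /=; ring.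
  case p_ik: (pos i k); last by case: (k == mate i) => /=; ring.
  by case: eqP => [kE|_]; [move: p_ik; rewrite kE pos_mate | rewrite /=; ring].
apply: sum_cyclic_dvd3 => [i j k|i k]; first by ring.
by case: sgA => _ _ ->; rewrite !mul0r.
Qed.

(** A second failure [v] would put two distinct elements into the complementary filter, whose size
    is one. *)
Lemma count_others (T : eqType) (f : pred T) (l : seq T) u :
  uniq l -> u \in l -> ~~ f u -> (count f l).+1 = size l ->
  forall v, v \in l -> f v = (v != u).
Proof.
move=> l_uniq ul fu cnt v vl; have [->|vu /=] := eqVneq v u; first exact: negbTE.
apply/negPn/negP => fv.
have : (size [:: u; v] <= size (filter (predC f) l))%N.
  apply: uniq_leq_size => [|x]; first by rewrite /= inE eq_sym vu.
  by rewrite !inE mem_filter /= => /orP[]/eqP->; apply/andP.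
by rewrite size_filter; have := count_predC f l; rewrite -cnt /=; lia.
Qed.

(** Serves to name all four positive neighbours of [i] once some of them are known. *)
Lemma pos_extend i l : uniq l -> all (pos i) l -> exists l',
  [/\ uniq (l ++ l'), (size l + size l' = 4)%N & forall j, pos i j = (j \in l ++ l')].
Proof.
move=> l_uniq l_pos; pose l' := [seq k <- enum 'I_n | pos i k && (k \notin l)].
have memE j : pos i j = (j \in l ++ l').
  rewrite mem_cat mem_filter mem_enum andbT.
  by case: (boolP (j \in l)) => [/(allP l_pos)->|_] /=; rewrite ?andbT.
have uniq_ll' : uniq (l ++ l').
  rewrite cat_uniq l_uniq filter_uniq ?enum_uniq // andbT /=.
  by apply/hasPn => k; rewrite mem_filter /= => /andP[/andP[]].
exists l'; split=> //; have [<- _] := card_edges i.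
rewrite -size_cat -(card_uniqP uniq_ll'); apply: eq_card => j.
by rewrite inE memE.
Qed.

Lemma codeg_count i j l : uniq l -> (forall k, pos i k = (k \in l)) ->
  codeg i j = count (pos j) l.
Proof.
move=> l_uniq nb; rewrite /codeg -size_filter -(card_uniqP (filter_uniq _ l_uniq)).
by apply: eq_card => k; rewrite inE mem_filter nb andbC.
Qed.

Lemma pos_neq i j : pos i j -> (i != j) && (i != mate j).
Proof.
move=> ij; apply/andP; split; apply: contraTneq ij => ->; first by rewrite posxx.
by rewrite posC pos_mate.
Qed.

(** For mates the corrections in [codegE] are loops and vanish, so [b] is itself a codegree. *)
Lemma codeg_mate i : (codeg i (mate i))%:Z = b.
Proof.
rewrite codegE sqE mateK !posxx pos_mate (negbTE (mate_neq i)).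
by rewrite eq_sym (negbTE (mate_neq i)) eqxx /=; ring.
Qed.

(** A codegree of 4 equals the degree in P, so the common neighbourhood is the whole
    neighbourhood. *)
Lemma mate_twins i j : b = 4 -> pos (mate i) j = pos i j.
Proof.
move=> b4; have codeg4 k : codeg k (mate k) = 4%N by have := codeg_mate k; rewrite b4 => -[].
suff imp k : pos k j -> pos (mate k) j by apply/idP/idP => /imp //; rewrite mateK.
have /eqP eq_nb : [set x | pos k x && pos (mate k) x] == [set x | pos k x].
  rewrite eqEcard; have [-> _] := card_edges k.
  have -> /= : (4 <= #|[set x | pos k x && pos (mate k) x]|)%N by rewrite -(codeg4 k).
  by rewrite andbT; apply/subsetP => x; rewrite !inE => /andP[].
move=> kj; have : j \in [set x | pos k x] by rewrite inE.
by rewrite -eq_nb inE => /andP[].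
Qed.

Lemma mate_twins_commute : b = 4 -> forall i j, pos (mate i) j = pos i (mate j).
Proof. by move=> b4 i j; rewrite mate_twins // [RHS]posC mate_twins // posC. Qed.

(** * Case where [mate] is an automorphism of P *)

Section Commuting.
Hypothesis pm : forall i j, pos (mate i) j = pos i (mate j).

Lemma pos_mates i j : pos (mate i) (mate j) = pos i j.
Proof. by rewrite pm mateK. Qed.

Lemma codeg_pos i j : pos i j -> (codeg i j)%:Z = a + 2 * (pos i (mate j))%:Z.
Proof.
move=> ij; rewrite codegE sqE pm ij.
have /andP[/negbTE i_j] := pos_neq ij; rewrite -eq_mate eq_sym => /negbTE->.
by rewrite eq_sym i_j /=; ring.
Qed.

Lemma codeg_nonadj i j : ~~ pos i j -> j != i -> j != mate i ->
  (codeg i j)%:Z = c + 2 * (pos i (mate j))%:Z.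
Proof.
move=> /negbTE ij /negbTE ji /negbTE jm.
by rewrite codegE sqE pm ij ji jm eq_sym ji /=; ring.
Qed.

(** [mate] permutes the common neighbours of [i] and [mate i] without fixed points. *)
Lemma even_b (i : 'I_n) : ~~ odd `|b|%N.
Proof.
rewrite -(codeg_mate i) /=; apply: (even_card_involution mateK mate_neq) => k.
by rewrite !inE pos_mates -pm andbC.
Qed.

Lemma b2_false (i : 'I_n) : b <> 2.
Proof.
move=> b2.
have : (0 < codeg i (mate i))%N by have := codeg_mate i; lia.
rewrite /codeg card_gt0 => /set0Pn[x]; rewrite inE pm => /andP[ix imx].
have [l' [uniq_l size_l nb]] : exists l', [/\ uniq ([:: x; mate x] ++ l'),
    (2 + size l' = 4)%N & forall j, pos i j = (j \in [:: x; mate x] ++ l')].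
  by apply: pos_extend; rewrite /= ?inE ?ix ?imx // eq_sym mate_neq.
case: l' size_l uniq_l nb => [|y [|z [|]]] // _ uniq_l nb.
have iy : pos i y by rewrite nb !inE eqxx !orbT.
(* As [b] is 2, the mates of [y] and [z] are not neighbours of [i]. Counting at [x] gives a + 2 =
   [xy] + [xz], and at [y] it gives a = [xy] + [y mate x] + [yz]. Hence a = 0, and [xy] would be
   both 1 and 0. *)
have := codeg_pos ix; have := codeg_pos iy; have := codeg_mate i.
rewrite !(codeg_count _ uniq_l nb) /= !pm !mateK imx ix !posxx !pos_mate (posC y x).
by clear -b2; lia.
Qed.

(** * Case b = 4: blown-up cycles *)

Lemma b4_twins i j : b = 4 -> pos i (mate j) = pos i j.
Proof. by move=> b4; rewrite -pm mate_twins. Qed.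

(** Twins enter a neighbourhood together, so the four neighbours form two pairs of mates: the
    quotient graph on pairs is 2-regular. *)
Lemma b4_nbrs i x : b = 4 -> pos i x -> exists y, [/\ y != x, y != mate x &
  uniq [:: x; mate x; y; mate y] /\
  forall j, pos i j = (j \in [:: x; mate x; y; mate y])].
Proof.
move=> b4 ix; have imx : pos i (mate x) by rewrite b4_twins.
have [l' [uniq_l size_l nb]] : exists l', [/\ uniq ([:: x; mate x] ++ l'),
    (2 + size l' = 4)%N & forall j, pos i j = (j \in [:: x; mate x] ++ l')].
  by apply: pos_extend; rewrite /= ?inE ?ix ?imx // eq_sym mate_neq.
case: l' size_l uniq_l nb => [|y [|z [|]]] // _ uniq_l nb.
have /andP[yx ymx] : (y != x) && (y != mate x).
  move: uniq_l; rewrite /= !inE !negb_or => /and4P[/and3P[_ xy _] /andP[mxy _] _ _].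
  by rewrite eq_sym xy eq_sym mxy.
have zE : z = mate y.
  have : pos i (mate y) by rewrite b4_twins // nb !inE eqxx !orbT.
  by rewrite nb !inE eq_mate (negbTE ymx) (inj_eq (can_inj mateK)) (negbTE yx)
    (negbTE (mate_neq y)) /= => /eqP.
by rewrite zE in uniq_l nb; exists y.
Qed.

Hypothesis conA : sg_connected A.

(** [v] picks one vertex from each pair of mates along the cycle; for twins, adjacency of these
    representatives determines all positive edges. *)
Lemma iso_S1 (m : nat) (v : nat -> 'I_n) : b = 4 ->
  all_pairs m.*2 (fun i j => (i == j) ||
    has (fun k => F_S1 m i k != F_S1 m j k) (iota 0 m.*2)) ->
  sg_regular (mx_of m.*2 (F_S1 m)) 5 -> (0 < m)%N ->
  (forall s t, (s < t)%N -> (t < m)%N -> [/\ v s != v t, v s != mate (v t)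
     & pos (v s) (v t) = ((t == s.+1 %% m) || (s == t.+1 %% m))%N]) ->
  sg_iso A (mx_of m.*2 (F_S1 m)).
Proof.
move=> b4 sepF regF m_gt0 vP.
have {}vP s t : s != t -> (s < m)%N -> (t < m)%N ->
    [/\ v s != v t, v s != mate (v t)
     & pos (v s) (v t) = ((t == s.+1 %% m) || (s == t.+1 %% m))%N].
  rewrite neq_ltn => /orP[] st sm tm; first exact: vP.
  have [ts tms vts] := vP _ _ st sm; split; last by rewrite posC vts orbC.
    by rewrite eq_sym.
  by rewrite eq_sym eq_mate.
(* This matches the numbering of [S1]: x_t at 2t, its mate y_t at 2t + 1. *)
pose g k := if odd k then mate (v k./2) else v k./2.
have pos_g s t : pos (g s) (g t) = pos (v s./2) (v t./2).
  by rewrite /g; do 2 case: ifP => _; rewrite ?pm ?mateK ?b4_twins.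
apply: (sg_iso_of_embedding (g := g) _ conA regA regF sepF) => [|s t sm tm].
  by rewrite double_gt0.
rewrite /F_S1 AE pos_g.
have [->|st] := eqVneq s t; first by rewrite posxx eq_sym (negbTE (mate_neq _)).
have [st2|st2] := eqVneq s./2 t./2.
  have odd_st : odd s = ~~ odd t.
    apply: contraNeq st => odd_st; rewrite -[s]odd_double_half -[t]odd_double_half st2.
    by move: odd_st; case: (odd s); case: (odd t).
  rewrite st2 posxx /g odd_st st2; case: (odd t) => /=; rewrite ?mateK eqxx //.
have [vst vstm ->] : [/\ v s./2 != v t./2, v s./2 != mate (v t./2)
   & pos (v s./2) (v t./2) = ((t./2 == s./2.+1 %% m) || (s./2 == t./2.+1 %% m))%N].
  by apply: vP => //; rewrite ltn_half_double.
have -> : (g t == mate (g s)) = false.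
  apply/negbTE; rewrite /g; do 2 case: ifP => _;
    by rewrite ?mateK ?(inj_eq (can_inj mateK)) eq_sym ?eq_mate.
by case: ifP.
Qed.

(** The cycle of pairs is explored from [i]: first [x] and [y] on either side, then [z] beyond [x]
    and [w] beyond [y]. An edge xy closes it at length 3, an edge yz at length 4; otherwise c = 2
    forces the edge zw and length 5. *)
Lemma b4_classification (i : 'I_n) : b = 4 ->
  [\/ sg_iso A (mx_of 6 (F_S1 3)), sg_iso A (mx_of 8 (F_S1 4))
    | sg_iso A (mx_of 10 (F_S1 5))].
Proof.
move=> b4.
have [[|x s]] := pos_extend (i := i) (l := [::]) isT isT; first by case.
case=> _ _ nb; have {nb s} ix : pos i x by rewrite nb inE eqxx.
have [y [yx ymx [uniq_i nb_i]]] := b4_nbrs b4 ix.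
have iy : pos i y by rewrite nb_i !inE eqxx !orbT.
have xi : pos x i by rewrite posC.
have yi : pos y i by rewrite posC.
have [z [zi zmi [uniq_x nb_x]]] := b4_nbrs b4 xi.
have xz : pos x z by rewrite nb_x !inE eqxx !orbT.
have edge u w : pos u w -> [/\ u != w, u != mate w & pos u w = true].
  by move=> uw; have /andP[-> ->] := pos_neq uw.
have [xy|xy] := boolP (pos x y).
  apply: Or31; apply: (@iso_S1 3 (nth i [:: i; x; y]) b4) => [|||].
  - by vm_compute.
  - by case: (regular_checkP regular_G1).
  - by [].
  by case=> [|[|[|s]]] [|[|[|t]]] //= _ _; exact: edge.
have [w [wi wmi [uniq_y nb_y]]] := b4_nbrs b4 yi.
have yw : pos y w by rewrite nb_y !inE eqxx !orbT.
have nonedge u w' : w' != u -> w' != mate u -> ~~ pos u w' ->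
    [/\ u != w', u != mate w' & pos u w' = false].
  by move=> wu wmu /negbTE->; split=> //; rewrite -?eq_mate eq_sym.
have iz : ~~ pos i z.
  apply: contra xy; rewrite nb_i !inE => /or4P[]/eqP zE; move: xz; rewrite zE.
  - by rewrite posxx.
  - by rewrite pos_mate.
  - by [].
  by rewrite b4_twins.
have [yz|yz] := boolP (pos y z).
  apply: Or32; apply: (@iso_S1 4 (nth i [:: i; x; z; y]) b4) => [|||].
  - by vm_compute.
  - by case: (regular_checkP regular_S1_8).
  - by [].
  case=> [|[|[|[|s]]]] [|[|[|[|t]]]] //= _ _;
    by [exact: edge | apply: edge; rewrite posC | exact: nonedge].
(* The common neighbours of the non-adjacent [i] and [z] are exactly [x] and its mate. *)
have c2 : c = 2.
  have := codeg_nonadj iz zi zmi; rewrite b4_twins // (negbTE iz).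
  rewrite (codeg_count _ uniq_i nb_i) /= !b4_twins // !(posC z) xz (negbTE yz) /= mulr0 addr0.
  by move<-.
have xw : ~~ pos x w.
  apply: contra yz; rewrite nb_x !inE (negbTE wi) (negbTE wmi) /=.
  by case/orP=> /eqP wE; move: yw; rewrite wE ?b4_twins.
have wx : w != x by apply: contraTneq yw => ->; rewrite posC.
have wmx : w != mate x by apply: contraTneq yw => ->; rewrite b4_twins // posC.
have iw : ~~ pos i w.
  rewrite nb_i !inE (negbTE wx) (negbTE wmx) /=; apply/norP; split.
    by apply: contraTneq yw => ->; rewrite posxx.
  by apply: contraTneq yw => ->; rewrite pos_mate.
(* [x] and [w] need c = 2 common neighbours; as [w] misses the pair of [i], they are [z] and its
   mate. *)
have zw : pos z w.
  have := codeg_nonadj xw wx wmx; rewrite b4_twins // (negbTE xw) c2.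
  rewrite (codeg_count _ uniq_x nb_x) /= !b4_twins // !(posC w) (negbTE iw) /=.
  by case: (pos z w).
have zy : ~~ pos z y by rewrite posC.
have y_z : y != z by apply: contraNneq xy => ->.
have y_mz : y != mate z by apply: contraNneq xy => ->; rewrite b4_twins.
apply: Or33; apply: (@iso_S1 5 (nth i [:: i; x; z; w; y]) b4) => [|||].
- by vm_compute.
- by case: (regular_checkP regular_S1_10).
- by [].
case=> [|[|[|[|[|s]]]]] [|[|[|[|[|t]]]]] //= _ _;
  by [exact: edge | apply: edge; rewrite posC | exact: nonedge].
Qed.

(** * Case b = 0: the graphs of order 10 other than a blown-up cycle *)

(** One criterion for both targets: [w] lists one half and [mate] maps it onto the other; [P] tells
    whether positive edges stay within the halves (two K_5) or cross between them (K_{5,5}). *)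
Lemma iso_double_cover (P : bool) (w : nat -> 'I_n) (F : nat -> nat -> int) :
  all_pairs 10 (fun s t => F s t ==
    if ((s < 5) == (t < 5))%N then (P && (s %% 5 != t %% 5)%N)%:Z
    else (~~ P && (s %% 5 != t %% 5)%N)%:Z - (s %% 5 == t %% 5)%N%:Z) ->
  all_pairs 10 (fun i j => (i == j) || has (fun k => F i k != F j k) (iota 0 10)) ->
  sg_regular (mx_of 10 F) 5 ->
  (forall s t, (s < 5)%N -> (t < 5)%N -> pos (w s) (w t) = P && (s != t)) ->
  (forall s t, (s < 5)%N -> (t < 5)%N -> pos (w s) (mate (w t)) = ~~ P && (s != t)) ->
  sg_iso A (mx_of 10 F).
Proof.
move=> FE sepF regF wP wQ.
pose g (s : nat) := if (s < 5)%N then w (s %% 5)%N else mate (w (s %% 5)%N).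
apply: (sg_iso_of_embedding (g := g) _ conA regA regF sepF) => // s t s10 t10.
have {FE} /eqP-> := all_pairsP (Ordinal s10) (Ordinal t10) FE; rewrite /= AE /g {g}.
have : (s %% 5 < 5)%N /\ (t %% 5 < 5)%N by rewrite !ltn_mod.
move: (s %% 5)%N (t %% 5)%N => s' t' [s5 t5].
(* A coincidence of [w] at distinct indices would by [wP] and [wQ] make both [P] and its negation
   false. *)
have w_inj : (w t' == w s') = (s' == t').
  rewrite eq_sym; have [->|st] := eqVneq s' t'; first exact: eqxx.
  apply: contraNF st => /eqP wst.
  have := wP _ _ s5 t5; have := wQ _ _ s5 t5; rewrite wst posxx pos_mate.
  by case: (P) => /=; case: eqP.
have w_mate : (w t' == mate (w s')) = false.
  apply/negP => /eqP wst.
  have := wP _ _ s5 t5; have := wQ _ _ s5 t5.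
  rewrite wst mateK posxx pos_mate.
  case: (eqVneq s' t') => [st|_]; last by case: (P).
  by move: (mate_neq (w s')); rewrite -wst st eqxx.
case: (s < 5)%N; case: (t < 5)%N => /=.
- by rewrite wP // w_mate subr0.
- by rewrite wQ // (inj_eq (can_inj mateK)) w_inj.
- by rewrite pm wQ // mateK w_inj.
by rewrite pos_mates wP // mateK eq_mate w_mate subr0.
Qed.

Section MatesApart.
Hypothesis b0 : b = 0.

Lemma apart i x : pos i x -> pos i (mate x) = false.
Proof.
move=> ix; apply/negP => imx.
have : codeg i (mate i) = 0%N by have := codeg_mate i; rewrite b0; case: codeg.
by move/eqP; rewrite cards_eq0 => /eqP/setP/(_ x); rewrite !inE ix pm imx.
Qed.

Variables (i : 'I_n) (l : seq 'I_n).
Hypotheses (uniq_l : uniq l) (size_l : size l = 4%N) (nb : forall k, pos i k = (k \in l)).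

Lemma nbr_mate u : (mate u \in l) -> u \in l -> False.
Proof. by rewrite -!nb => + iu; rewrite apart. Qed.

Lemma count_pos u : u \in l -> (count (pos u) l)%:Z = a.
Proof.
rewrite -nb => iu; rewrite -(codeg_count _ uniq_l nb) codeg_pos // apart //=.
by rewrite mulr0 addr0.
Qed.

(** This is the codegree of [i] and the non-adjacent vertex [mate u]; the 2 comes from the edge
    between [i] and [u]. *)
Lemma count_mate u : u \in l -> (count (fun v => pos u (mate v)) l)%:Z = c + 2.
Proof.
rewrite -nb => iu.
have -> : count (fun v => pos u (mate v)) l = count (pos (mate u)) l.
  by apply: eq_count => v; rewrite pm.
rewrite -(codeg_count _ uniq_l nb) codeg_nonadj ?mateK ?iu //.
- by rewrite apart.
- by rewrite eq_mate; apply: contraTneq iu => ->; rewrite pos_mate.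
by rewrite (inj_eq (can_inj mateK)) eq_sym; case/andP: (pos_neq iu).
Qed.

Lemma count_pos_mate u :
  (count (pos u) l + count (fun v => pos u (mate v)) l =
   count (fun v => pos u v || pos u (mate v)) l)%N.
Proof.
rewrite -count_predUI [X in (_ + X)%N](_ : _ = 0%N) ?addn0 //.
apply/eqP; rewrite -leqn0 leqNgt -has_count; apply/hasPn => v _ /=.
by case uv: (pos u v); rewrite // apart.
Qed.

Lemma sum_count_le3 u : u \in l ->
  (count (pos u) l + count (fun v => pos u (mate v)) l <= 3)%N.
Proof.
move=> ul; rewrite count_pos_mate -ltnS -size_l.
rewrite -(count_predC (fun v => pos u v || pos u (mate v))).
rewrite -[X in (X < _)%N]addn0 ltn_add2l -has_count; apply/hasP; exists u => //=.
by rewrite posxx pos_mate.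
Qed.

(** By [apart], the vertex [i], its mate, its four neighbours and their mates are all distinct. *)
Lemma order_ge10 : (10 <= n)%N.
Proof.
have ul : uniq ([:: i; mate i] ++ l ++ map mate l).
  rewrite cat_uniq /= inE eq_sym mate_neq /= cat_uniq uniq_l.
  rewrite (map_inj_uniq (can_inj mateK)) uniq_l.
  rewrite andbT; apply/andP; split; last first.
    apply/hasPn => _ /mapP[u ul ->]; apply/negP => /nbr_mate; exact.
  have memE u : (u \in l ++ map mate l) = (pos i u || pos i (mate u)).
    by rewrite mem_cat -{2}[u]mateK (mem_map (can_inj mateK)) !nb.
  apply/hasPn => u; rewrite memE !inE negb_or => iu.
  apply/andP; split; apply: contraTneq iu => ->; first by rewrite posxx pos_mate.
  by rewrite mateK posxx pos_mate.
have := max_card (mem ([:: i; mate i] ++ l ++ map mate l)).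
by rewrite (card_uniqP ul) card_ord !size_cat size_map /= size_l.
Qed.

Lemma apart_params :
  [\/ a = 3 /\ c = -2, a = 0 /\ c = 1 | 1 <= a <= 2 /\ a + c = 1].
Proof.
have [u ul] : exists u, u \in l by case: l size_l => [|u s] // _; exists u; rewrite inE eqxx.
have := param_count i; have := count_pos ul; have := count_mate ul.
have := sum_count_le3 ul; have := order_ge10; rewrite b0.
move: (count (pos u) l) (count (fun v => pos u (mate v)) l) => p q; clear => n10 pq qc pa.
have -> : c = q%:Z - 2 by lia.
rewrite -pa => cnt.
have : (q <= 3)%N by lia.
(* With p = a and q = c + 2 the equation is 4p + (q - 2)(n - 6) = 4; since p + q <= 3 and n >= 10,
   each [q] fixes [p]. *)
case: q cnt pq {qc} => [|[|[|[|q]]]] //= cnt pq _.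
- by apply: Or31; lia.
- by apply: Or33; lia.
- by apply: Or33; lia.
by apply: Or32; lia.
Qed.

(** The neighbours of [x] include [i], [a] members of [l] and c + 2 mates of members; when a + c = 1
    these are all four. *)
Lemma codeg_nbrs x y : a + c = 1 -> x \in l -> y \in l ->
  codeg x y = (1 + count (fun v => pos x v && pos y v) l
    + count (fun v => pos x (mate v) && pos y (mate v)) l)%N.
Proof.
move=> ac xl yl.
pose q u v := pos u (mate v).
pose lx := i :: filter (pos x) l ++ map mate (filter (q x) l).
have il : i \notin l by rewrite -nb posxx.
have uniq_lx : uniq lx.
  rewrite /= mem_cat mem_filter (negbTE il) andbF /= cat_uniq !filter_uniq //.
  rewrite map_inj_uniq ?filter_uniq //; last exact: can_inj mateK.
  apply/and3P; split=> //.
    apply/mapP => -[v]; rewrite mem_filter -nb => /andP[_ iv] iE.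
    by rewrite iE posC pos_mate in iv.
  apply/andP; split=> //; apply/hasPn => _ /mapP[v + ->]; rewrite !mem_filter => /andP[_ vl].
  by apply/negP => /andP[_ /nbr_mate]; exact.
have size_lx : size lx = 4%N.
  have := count_pos xl; have := count_mate xl.
  by rewrite /= size_cat size_map !size_filter; move: (count _ l) (count _ l); clear -ac; lia.
have pos_lx : all (pos x) lx.
  rewrite /= posC nb xl all_cat filter_all /= all_map.
  by apply/allP => v; rewrite mem_filter => /andP[].
have [[|? ?] [_ sz nb_x]] := pos_extend uniq_lx pos_lx; last by rewrite size_lx in sz.
rewrite cats0 in nb_x.
rewrite (codeg_count _ uniq_lx nb_x) /= posC nb yl count_cat count_map !count_filter.
rewrite addnA; congr (_ + _ + _)%N; apply: eq_count => v /=; exact: andbC.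
Qed.
End MatesApart.

(** P induces an a-regular graph on the neighbours of [i]: a perfect matching or a 4-cycle. For an
    edge xy of it [codeg_nbrs] gives 3 or 1 respectively, whereas [codeg_pos] demands 1 or 2. *)
Lemma apart_exceptional (i : 'I_n) : b = 0 -> 1 <= a <= 2 -> a + c = 1 -> False.
Proof.
move=> b0 a12 ac.
have [l0 []] := pos_extend (i := i) (l := [::]) isT isT.
rewrite /= add0n => uniq_l0 size_l0 nb0.
case: l0 uniq_l0 size_l0 nb0 => [|x l0] // uniq_l0 size_l0 nb0.
have [y yl xy] : exists2 y, y \in x :: l0 & pos x y.
  apply/hasP; rewrite has_count.
  have : (0 < (count (pos x) (x :: l0))%:Z)%R.
    by rewrite (count_pos b0 uniq_l0 nb0 (mem_head x l0)); move: a12; clear; lia.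
  by [].
have uniq_xy : uniq [:: x; y] by rewrite /= inE; case/andP: (pos_neq xy) => ->.
have pos_xy : all (pos i) [:: x; y] by rewrite /= !nb0 mem_head yl.
have [l' []] := pos_extend uniq_xy pos_xy.
rewrite /cat; case: l' => [|z [|w [|? ?]]] // uniq_l _ nb.
(* The two counts add up to a + c + 2 = 3, so [u] is adjacent to each other neighbour of [i] or to
   its mate. *)
have sum3 u : u \in [:: x; y; z; w] -> forall v, v \in [:: x; y; z; w] ->
    pos u v || pos u (mate v) = (v != u).
  move=> ul; pose f v := pos u v || pos u (mate v).
  apply: (@count_others _ f [:: x; y; z; w] u); rewrite /f //=.
    by rewrite posxx pos_mate.
  have := count_pos_mate b0 [:: x; y; z; w] u.
  have := count_pos b0 uniq_l nb ul; have := count_mate b0 uniq_l nb ul.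
  rewrite /=; clear -ac; lia.
have qE u v : u \in [:: x; y; z; w] -> v \in [:: x; y; z; w] ->
    pos u (mate v) = (v != u) && ~~ pos u v.
  move=> ul vl; rewrite -(sum3 u ul v vl); case uv: (pos u v) => /=; last by rewrite andbT.
  by rewrite apart.
have mem_l : [/\ x \in [:: x; y; z; w], y \in [:: x; y; z; w], z \in [:: x; y; z; w]
  & w \in [:: x; y; z; w]] by rewrite !inE !eqxx !orbT.
case: mem_l => xl yl' zl wl.
have := codeg_nbrs b0 uniq_l nb ac xl yl'.
have := codeg_pos xy; rewrite apart //.
have := count_pos b0 uniq_l nb xl; have := count_pos b0 uniq_l nb yl'.
have := count_pos b0 uniq_l nb zl; have := count_pos b0 uniq_l nb wl.
rewrite /= !qE // !posxx ![pos _ x]posC ![pos w _]posC [pos z y]posC xy /=.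
move: uniq_l; rewrite /= !inE !negb_or => /and4P[/and3P[xy' xz xw] /andP[yz yw] zw _].
rewrite !eqxx (eq_sym y x) (eq_sym z x) (eq_sym z y) (eq_sym w x) (eq_sym w y).
rewrite (negbTE xy') (negbTE xz) (negbTE xw) (negbTE yz) (negbTE yw) /=.
move: (pos x z) (pos x w) (pos y z) (pos y w) (pos z w) => [] [] [] [] [] /=; clear -a12; lia.
Qed.

Lemma b0_classification (i : 'I_n) : b = 0 ->
  sg_iso A (mx_of 10 F_S2) \/ sg_iso A (mx_of 10 F_S3).
Proof.
move=> b0; have [l []] := pos_extend (i := i) (l := [::]) isT isT.
rewrite /= add0n => uniq_l size_l nb.
have cp u (ul : u \in l) := count_pos b0 uniq_l nb ul.
have cq u (ul : u \in l) := count_mate b0 uniq_l nb ul.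
have nth_l k : (k < 4)%N -> nth i l k \in l by rewrite -size_l; exact: mem_nth.
have nth_eq s t : (s < 4)%N -> (t < 4)%N -> (nth i l s == nth i l t) = (s == t).
  by move=> s4 t4; rewrite nth_uniq ?size_l.
case: (apart_params b0 uniq_l size_l nb) => [[a3 c2]|[a0 c1]|[a12 ac]].
(* Each neighbour of [i] is adjacent to the three others, so [i :: l] is a positive K_5. *)
- right; have all_pos u v : u \in l -> v \in l -> pos u v = (v != u).
    move=> ul; apply: count_others; rewrite ?posxx //.
    by have := cp u ul; rewrite a3 size_l => -[->].
  have no_mate u v : u \in l -> v \in l -> pos u (mate v) = false.
    move=> ul vl; have [->|uv] := eqVneq v u; first exact: pos_mate.
    by apply: apart => //; rewrite all_pos.
  apply: (@iso_double_cover true (nth i (i :: l))) => [|||s t s5 t5|s t s5 t5].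
  + by vm_compute.
  + by vm_compute.
  + by case: (regular_checkP regular_S3_10).
  + case: s t s5 t5 => [|s] [|t] //= s5 t5; rewrite ?posxx ?[pos _ i]posC ?nb ?nth_l //.
    by rewrite all_pos ?nth_l // nth_eq // eq_sym eqSS.
  case: s t s5 t5 => [|s] [|t] //= s5 t5; first exact: pos_mate.
  + by rewrite apart // nb nth_l.
  + by rewrite -pm posC apart // nb nth_l.
  by rewrite no_mate ?nth_l.
(* Each neighbour of [i] is adjacent to the mates of the three others, so one side of K_{5,5}
   consists of [i] and the mates of its neighbours. *)
- left; have all_mate u v : u \in l -> v \in l -> pos u (mate v) = (v != u).
    move=> ul; apply: (count_others (f := fun v => pos u (mate v))); rewrite ?pos_mate //.
    by have := cq u ul; rewrite c1 size_l => -[->].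
  have no_pos u v : u \in l -> v \in l -> pos u v = false.
    move=> ul vl; have [->|uv] := eqVneq v u; first exact: posxx.
    by apply/negP => /(apart b0); rewrite all_mate // uv.
  apply: (@iso_double_cover false (nth i (i :: map mate l))) => [|||s t s5 t5|s t s5 t5].
  + by vm_compute.
  + by vm_compute.
  + by case: (regular_checkP regular_S2_10).
  + case: s t s5 t5 => [|s] [|t] //= s5 t5; rewrite ?(nth_map i) ?size_l ?posxx //.
    * by rewrite apart // nb nth_l.
    * by rewrite posC apart // nb nth_l.
    by rewrite pos_mates no_pos ?nth_l.
  case: s t s5 t5 => [|s] [|t] //= s5 t5; rewrite ?(nth_map i) ?size_l ?pos_mate //.
  + by rewrite mateK nb nth_l.
  + by rewrite pos_mates posC nb nth_l.
  by rewrite mateK pm all_mate ?nth_l // nth_eq // eq_sym eqSS.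
by case: (apart_exceptional i b0 a12 ac).
Qed.
End Commuting.

(** * Bounds on the parameters and the case a + b = 2c *)

Lemma order_ge6 (i : 'I_n) : (6 <= n)%N.
Proof.
have := max_card (mem (i |: [set j | adjacent A i j])).
rewrite cardsU1 -/(degree A i) regA card_ord inE /adjacent.
by case: sgA => _ _ ->.
Qed.

Lemma b_bounds (i : 'I_n) : 0 <= b <= 4.
Proof.
rewrite -(codeg_mate i) /= -[4]/(Posz 4) lez_nat.
have [<- _] := card_edges i; apply/subset_leq_card/subsetP => k.
by rewrite !inE => /andP[].
Qed.

(** On a positive edge [codegE] makes the codegree [a] plus two booleans, and it is nonnegative. *)
Lemma a_bound (i : 'I_n) : -2 <= a.
Proof.
have [x] : exists x, x \in [set x | pos i x].
  by apply/set0Pn; rewrite -card_gt0; have [-> _] := card_edges i.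
rewrite inE => ix; have := codegE i x; rewrite sqE ix.
have /andP[/negbTE i_x /negbTE imx] := pos_neq ix.
rewrite eq_sym i_x eq_sym eq_mate imx.
by case: (pos i _); case: (pos _ x); clear; lia.
Qed.

Lemma noncommuting_b4 (i : 'I_n) : a + b = 2 * c -> b = 4.
Proof.
move=> abc; have := param_count i; have := order_ge6 i; have := b_bounds i.
have := a_bound i; have := triangles_dvd3; have := even_order.
move: abc; clear; move=> abc n_even tri a_ge b_bd n_ge6 cnt.
(* Doubling [cnt] and substituting 2c = a + b eliminates [c]. *)
have key : a * (n%:Z + 2) = 8 - b * (n%:Z - 4) by nia.
have a_lt : a < 2 by nia.
have : [\/ a = -2, a = -1, a = 0 | a = 1].
  by case: (a) a_ge a_lt => [[|[|?]]|[|[|?]]] //; do ?[by constructor]; lia.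
have : [\/ b = 0, b = 1, b = 2 | b = 3] \/ b = 4.
  by case: (b) b_bd => [[|[|[|[|[|?]]]]]|?]; rewrite /= ?andbF //;
    by [left; constructor | right | lia].
(* [key] and the parities of a + b and [n] leave only (n, a, b, c) = (8, 0, 2, 1), where n (4a - b)
   = -16 contradicts [tri]. *)
case=> [[] b_ | ->] // [] a_; rewrite a_ b_ in abc cnt key tri *; exfalso; lia.
Qed.
End SignedGraph.

(** * Assembly of the classification *)

Lemma srsg_classification (n : nat) (A : 'M[int]_n) :
  signed_adj A -> sg_connected A -> sg_regular A 5 -> net_regular A 3 -> is_SRSG A ->
  sg_iso A G1 \/ sg_iso A S1_8 \/ sg_iso A S1_10 \/ sg_iso A S2_10 \/ sg_iso A S3_10.
Proof.
move=> sgA conA regA netA [[_ not_edgeless] [r [a [b [c cond]]]]].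
(* The graph on no vertices is edgeless, so a vertex exists. *)
have i : 'I_n.
  by case: n A not_edgeless {sgA conA regA netA cond} => [A []|n _ _]; [case | exact: ord0].
have comm : forall i j, pos A (mate A i) j = pos A i (mate A j).
  (* When a + b = 2c, [b] is 4 and mates are twins, so [mate] commutes with P in this case too. *)
  have [/(noncommuting_b4 sgA regA netA cond i)|//] := mate_commutes sgA regA netA cond.
  exact: (mate_twins_commute sgA regA netA cond).
have := even_b sgA regA netA cond comm i; have := b_bounds sgA regA netA cond i.
case: b cond => [[|[|[|[|[|b]]]]]|b] cond //= _ _.
- by case: (b0_classification sgA regA netA cond comm conA i) => //; tauto.
- by case: (b2_false sgA regA netA cond comm i).
rewrite G1E.
by case: (b4_classification sgA regA netA cond comm conA i) => //; tauto.
Qed.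

Theorem theorem3p3 :
  (* classification: every connected 5-regular, 3 net-regular SRSG is one of the five *)
  (forall (n : nat) (A : 'M[int]_n),
      signed_adj A -> sg_connected A -> sg_regular A 5 -> net_regular A 3 ->
      is_SRSG A ->
      (sg_iso A G1 \/ sg_iso A S1_8 \/ sg_iso A S1_10 \/ sg_iso A S2_10 \/
       sg_iso A S3_10)) /\
  (* each of the five is a connected, 5-regular, 3 net-regular signed graph *)
  [/\ [/\ signed_adj G1, sg_connected G1, sg_regular G1 5 & net_regular G1 3],
      [/\ signed_adj S1_8, sg_connected S1_8, sg_regular S1_8 5 & net_regular S1_8 3],
      [/\ signed_adj S1_10, sg_connected S1_10, sg_regular S1_10 5 & net_regular S1_10 3],
      [/\ signed_adj S2_10, sg_connected S2_10, sg_regular S2_10 5 & net_regular S2_10 3] &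
      [/\ signed_adj S3_10, sg_connected S3_10, sg_regular S3_10 5 & net_regular S3_10 3]] /\
  (* their SRSG parameters *)
  [/\ SRSG_params4 G1 5 0 4,
      SRSG_params5 S1_8 5 (-2) 4 4,
      SRSG_params5 S1_10 5 (-2) 4 2,
      SRSG_params5 S2_10 5 0 0 1 &
      SRSG_params5 S3_10 5 3 0 (-2)] /\
  (* the five are pairwise non-isomorphic *)
  ([/\ ~ sg_iso G1 S1_8, ~ sg_iso G1 S1_10, ~ sg_iso G1 S2_10 & ~ sg_iso G1 S3_10] /\
   [/\ ~ sg_iso S1_8 S1_10, ~ sg_iso S1_8 S2_10 & ~ sg_iso S1_8 S3_10] /\
   [/\ ~ sg_iso S1_10 S2_10, ~ sg_iso S1_10 S3_10 & ~ sg_iso S2_10 S3_10]).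
Proof.
split; first exact: srsg_classification.
split; last by split; [exact: params_five | exact: five_distinct].
split; first (by rewrite G1E; exact: (regular_checkP regular_G1)).
- exact: (regular_checkP regular_S1_8).
- exact: (regular_checkP regular_S1_10).
- exact: (regular_checkP regular_S2_10).
exact: (regular_checkP regular_S3_10).
Qed.
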